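(* For every positive integer $k$ and every real $x$ with $0\le x\le\frac3{5k-2}$, $$p_k(x)=\max\{1-(1-x)^k,\ (kx)^k\}.$$
   Context: $p_k(x):=\sup\Pr[X_1+\dots+X_k\ge1]$, where the supremum is over all $k$-tuples $(X_1,\dots,X_k)$ of nonnegative, independent, identically distributed random variables with mean $x$. *)

(* Defs.v *)
From HB Require Import structures.
From mathcomp Require Import all_boot all_order all_algebra.
From mathcomp Require Import all_classical all_reals all_analysis.

Set Implicit Arguments.
Unset Strict Implicit.
Unset Printing Implicit Defensive.

Import Order.TTheory GRing.Theory Num.Theory.

Local Open Scope classical_set_scope.
Local Open Scope ring_scope.

Definition mutually_independent (R : realType) (d : measure_display)
    (T : measurableType d) (P : probability T R) (k : nat)
    (X : 'I_k -> {RV P >-> R}) : Prop :=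
  forall (J : {set 'I_k}) (A : 'I_k -> set R),
    (forall i, measurable (A i)) ->
    P (\bigcap_(i in [set i | i \in J]) (X i @^-1` A i)) =
    (\prod_(i in J) P (X i @^-1` A i))%E.

Definition identically_distributed (R : realType) (d : measure_display)
    (T : measurableType d) (P : probability T R) (k : nat)
    (X : 'I_k -> {RV P >-> R}) : Prop :=
  forall (i j : 'I_k) (A : set R), measurable A ->
    distribution P (X i) A = distribution P (X j) A.

(* The probability space is part of the data over which the supremum is
   taken. *)
Definition max_tail (R : realType) (k : nat) (x : R) : \bar R :=
  ereal_sup [set q : \bar R |
    exists (d : measure_display) (T : measurableType d) (P : probability T R)
           (X : 'I_k -> {RV P >-> R}),
      [/\ forall i w, 0 <= X i w,
          mutually_independent X,
          identically_distributed X,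
          forall i, ('E_P[X i] = x%:E)%E
        & q = P [set w | 1 <= \sum_(i < k) X i w]]].

(* Main.v *)
Require Import Defs.
From HB Require Import structures.
From mathcomp Require Import all_boot all_order all_algebra.
From mathcomp Require Import all_classical all_reals all_analysis.
From mathcomp Require Import measurable_realfun ring lra.

Set Implicit Arguments.
Unset Strict Implicit.
Unset Printing Implicit Defensive.

Import Order.TTheory GRing.Theory Num.Theory.
Local Open Scope ring_scope.

(* In this range the first term is the maximum, and it is attained by Bernoulli
   variables.  For the upper bound, rounding the variables down to multiples of
   1/N and thinning them slightly reduces the problem to finitely supported laws,
   and mixing with an atom at 1 reduces it to x = 3/(5k-2).  Split the law as
   x Y + (1-x) Z, where Y is the conditional law of the top x-quantile, so that
   Z <= z <= Y, and let S_j be a sum of j copies of Z, n = 1 - E Y, r = x/(1-x).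
   Comparing with the event "no variable falls in the top part", it is enough
   to show that
     P(S_k >= 1) <= k r P(Y + S_(k-1) < 1)
                    + k(k-1)/2 r^2 P(Y + Y' + S_(k-2) < 1).
   Size biasing gives P(S_k >= 1) <= k E[Z] P(S_(k-1) >= 1 - z), with
   E[Z] <= r n, and (k-1) r = 3/5 at the extreme value of x; so the claim follows
   from
     n P(S >= 1 - z) <= P(Y + S < 1) + 3/10 P(Y + Y' + S < 1),   S = S_(k-1),
   where E[S] <= 3/5 n.  If z >= 1/4 or E[Y] >= 1/3 this is an affine bound in S
   followed by Markov's inequality; otherwise the bound E[S^2] <= E[S] (E[S] + z)
   suffices, without the last term. *)

(** * Finitely supported laws *)

Section FiniteLaws.
Context {R : realType}.
Implicit Types (L M Y Z : seq (R * R)) (f g h : R -> R).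

(* A law is a list of pairs (probability, value), possibly unnormalised; [avg L f s]
   is the expectation of [f (s + X)] for [X] of law [L], so that [iter j (avg L) f 0]
   is the expectation of [f] at a sum of [j] independent copies. *)
Definition avg L f s : R := \sum_(a <- L) a.1 * f (s + a.2).

Definition mass L : R := \sum_(a <- L) a.1.

Definition mean L : R := \sum_(a <- L) a.1 * a.2.

(** Left unnormalised, with total mass [mean L], so that no division by a possibly zero mean
    occurs. *)
Definition size_bias L := [seq (a.1 * a.2, a.2) | a <- L].

Definition nneg L := all (fun a : R * R => (0 <= a.1) && (0 <= a.2)) L.

Lemma avgE_lin L c f g :
  avg L (fun t => c * f t + g t) = fun s => c * avg L f s + avg L g s.
Proof.
apply/funext => s; rewrite /avg big_distrr -big_split /=.
by apply: eq_bigr => a _; ring.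
Qed.

Lemma avg_cst L c s : avg L (fun=> c) s = mass L * c.
Proof. by rewrite /avg -big_distrl. Qed.

Lemma avgC L M f : avg L (avg M f) = avg M (avg L f).
Proof.
apply/funext => s; rewrite /avg.
under eq_bigr do rewrite big_distrr.
rewrite exchange_big; apply: eq_bigr => a _; rewrite big_distrr.
by apply: eq_bigr => b _ /=; rewrite -!addrA (addrC a.2); ring.
Qed.

Lemma iter_avgC L M j f : avg M (iter j (avg L) f) = iter j (avg L) (avg M f).
Proof. by elim: j => //= j <-; rewrite avgC. Qed.

Lemma avg_shift L f y s : avg L (fun t => f (t + y)) s = avg L f (s + y).
Proof. by apply: eq_bigr => a _; rewrite addrAC. Qed.

Lemma iter_avg_shift L j f y s :
  iter j (avg L) (fun t => f (t + y)) s = iter j (avg L) f (s + y).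
Proof.
elim: j s => //= j IH s; rewrite -avg_shift.
by congr avg; apply/funext => t; rewrite IH.
Qed.

Lemma ler_avg L f g s : nneg L -> (forall t, s <= t -> f t <= g t) ->
  avg L f s <= avg L g s.
Proof.
move=> /allP L0 fg; rewrite /avg !big_seq; apply: ler_sum => a /L0 /andP[a1 a2].
by rewrite ler_wpM2l// fg// lerDl.
Qed.

Lemma ler_iter_avg L j f g s : nneg L -> (forall t, s <= t -> f t <= g t) ->
  iter j (avg L) f s <= iter j (avg L) g s.
Proof.
move=> L0; elim: j s => /= [s fg|j IH s fg]; first exact: fg.
by apply: ler_avg => // t st; apply: IH => u tu; apply: fg (le_trans st tu).
Qed.

Lemma iter_avg_cst L j c s : mass L = 1 -> iter j (avg L) (fun=> c) s = c.
Proof.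
move=> L1; elim: j s => //= j IH s.
by rewrite (_ : iter j _ _ = fun=> c) ?avg_cst ?L1 ?mul1r//; exact/funext.
Qed.

Lemma iter_avg_lin L j c f g :
  iter j (avg L) (fun t => c * f t + g t) =
  fun s => c * iter j (avg L) f s + iter j (avg L) g s.
Proof. by elim: j => //= j ->; rewrite avgE_lin. Qed.

Lemma iter_avg_ge0 L j f s : nneg L -> (forall t, s <= t -> 0 <= f t) ->
  0 <= iter j (avg L) f s.
Proof.
move=> L0 f0; rewrite (_ : 0 = iter j (avg L) (fun=> 0) s); first exact: ler_iter_avg.
by elim: j {f0} s => //= j IH s; rewrite /avg big1// => a _; rewrite -IH mulr0.
Qed.

(** By exchangeability the [j] summands contribute equally to the factor [t], and weighting one
    summand by its value amounts to averaging it over [size_bias L]. At [j = 0] the factor [j%:R]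
    makes [j.-1] harmless. *)
Lemma iter_avg_id_mul L j h s :
  iter j (avg L) (fun t => t * h t) s =
  s * iter j (avg L) h s + j%:R * avg (size_bias L) (iter j.-1 (avg L) h) s.
Proof.
elim: j s => [|j IH] s; first by rewrite mul0r addr0.
have biasE g u : avg L (fun t => t * g t) u = u * avg L g u + avg (size_bias L) g u.
  rewrite /avg big_map big_distrr -big_split /=.
  by apply: eq_bigr => a _; ring.
rewrite /= (_ : iter j _ _ = fun t => j%:R * avg (size_bias L) (iter j.-1 (avg L) h) t
   + t * iter j (avg L) h t); last by apply/funext => t; rewrite IH addrC.
rewrite avgE_lin biasE avgC; case: j {IH} => [|j] /=; first by ring.
by rewrite [in RHS]mulrSr; ring.
Qed.

Lemma mass_size_bias L : mass (size_bias L) = mean L.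
Proof. by rewrite /mass big_map. Qed.

Lemma mean_ge0 L : nneg L -> 0 <= mean L.
Proof.
by move=> /allP L0; rewrite /mean big_seq; apply: sumr_ge0 => a /L0 /andP[? ?]; exact: mulr_ge0.
Qed.

Lemma nneg_size_bias L : nneg L -> nneg (size_bias L).
Proof.
move=> /allP L0; rewrite /nneg all_map; apply/allP => a /L0 /andP[a1 a2] /=.
by rewrite a2 mulr_ge0.
Qed.

Lemma iter_avg_id L j : mass L = 1 -> iter j (avg L) id 0 = j%:R * mean L.
Proof.
move=> L1; have -> : id = (fun t : R => t * 1) by apply/funext => t; rewrite mulr1.
rewrite iter_avg_id_mul mul0r add0r; congr (_ * _).
rewrite (_ : iter j.-1 _ _ = fun=> 1) ?avg_cst ?mass_size_bias ?mulr1//.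
by apply/funext => s; rewrite iter_avg_cst.
Qed.

(** Size biasing writes the second moment as [j] times the expectation of X (X + S'), with S' the
    sum of the other copies; then X is at most [z] and S' has mean at most [j%:R * mean L]. *)
Lemma iter_avg_sqr_le L j z : nneg L -> mass L = 1 ->
  all (fun a => a.2 <= z) L ->
  iter j (avg L) (fun t => t * t) 0 <=
  (j%:R * mean L) * (j%:R * mean L + z).
Proof.
move=> L0 L1 Lz; rewrite iter_avg_id_mul mul0r add0r -mulrA ler_wpM2l ?ler0n//.
have L'0 := nneg_size_bias L0; have mL := mean_ge0 L0.
rewrite iter_avgC.
case: j => [|j].
  rewrite /= mul0r add0r /avg big_map /mean mulr_suml 2!big_seq; apply: ler_sum => a aL /=.
  move/allP: L0 => /(_ _ aL)/andP[? ?]; rewrite add0r ler_wpM2l ?mulr_ge0//.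
  by move/allP: Lz => /(_ _ aL).
have -> : mean L * (j.+1%:R * mean L + z) =
    iter j (avg L) (fun t => mean L * t + mean L * (z + mean L)) 0.
  rewrite iter_avg_lin iter_avg_cst// iter_avg_id// -[j.+1]addn1 natrD; ring.
apply: ler_iter_avg => // t t0.
rewrite -mulrDr /avg big_map {1}/mean mulr_suml 2!big_seq; apply: ler_sum => a aL /=.
move/allP: L0 => /(_ _ aL)/andP[? ?]; rewrite ler_wpM2l ?mulr_ge0//.
move/allP: Lz => /(_ _ aL); lra.
Qed.

(** * Markov bounds and the two comparison inequalities *)

Definition lt1 (t : R) : R := (t < 1)%R%:R.

Lemma lt1_ge0 t : 0 <= lt1 t. Proof. exact: ler0n. Qed.

Lemma lt1_le1 t : lt1 t <= 1. Proof. by rewrite /lt1; case: ltP. Qed.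

Lemma ler_lt1 s t : s <= t -> lt1 t <= lt1 s.
Proof. by rewrite /lt1 => st; case: (ltP t); case: (ltP s) => //; lra. Qed.

Lemma avg_in01 L f s : nneg L -> mass L = 1 -> (forall t, 0 <= f t <= 1) ->
  0 <= avg L f s <= 1.
Proof.
move=> L0 L1 f01; apply/andP; split.
  by apply: (@iter_avg_ge0 L 1) => // t _; have /andP[] := f01 t.
rewrite -[leRHS](@iter_avg_cst L 1 1 s) //=.
by apply: ler_avg => // t _; have /andP[] := f01 t.
Qed.

Lemma lt1_in01 t : 0 <= lt1 t <= 1. Proof. by rewrite lt1_ge0 lt1_le1. Qed.

Lemma mean_ge Y z : nneg Y -> mass Y = 1 -> all (fun a => z <= a.2) Y -> z <= mean Y.
Proof.
move=> /allP Y0 Y1 /allP Yz; rewrite -[z]mul1r -Y1 /mass mulr_suml /mean 2!big_seq.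
by apply: ler_sum => a aY; rewrite ler_wpM2l ?Yz//; case/andP: (Y0 _ aY).
Qed.

Lemma avg_le_affine L f c d s : nneg L -> mass L = 1 ->
  (forall a, a \in L -> f (s + a.2) <= c * a.2 + d) ->
  avg L f s <= c * mean L + d.
Proof.
move=> /allP L0 L1 fL; rewrite -[d]mul1r -L1 /mass /mean mulr_sumr mulr_suml -big_split /=.
rewrite /avg 2!big_seq; apply: ler_sum => a aL.
case/andP: (L0 _ aL) => a1 _; rewrite mulrCA -mulrDr ler_wpM2l//; exact: fL.
Qed.

(** Markov's inequality for Y - z at level 1 - z - s, multiplied out so that it survives a
    nonpositive level. *)
Lemma markov_above Y z s : nneg Y -> mass Y = 1 -> all (fun a => z <= a.2) Y ->
  (1 - z - s) * (1 - avg Y lt1 s) <= mean Y - z.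
Proof.
move=> Y0 Y1 /allP Yz.
have -> : (1 - z - s) * (1 - avg Y lt1 s) =
   avg Y (fun t => (z + s - 1) * lt1 t + (1 - z - s)) s.
  by rewrite avgE_lin avg_cst Y1; ring.
rewrite -[mean Y]mul1r; apply: avg_le_affine => // a aY; have := Yz _ aY.
by rewrite /lt1; case: ltP => /= ? ?; lra.
Qed.

(** Given the first copy, [markov_above] at the shifted point handles the second; the excess
    [a.2 - z] of the first makes up the difference of levels. *)
Lemma markov_above2 Y z s : nneg Y -> mass Y = 1 -> all (fun a => z <= a.2) Y ->
  (1 - 2 * z - s) * (1 - avg Y (avg Y lt1) s) <= 2 * (mean Y - z).
Proof.
move=> Y0 Y1 Yz.
have -> : (1 - 2 * z - s) * (1 - avg Y (avg Y lt1) s) =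
   avg Y (fun t => (2 * z + s - 1) * avg Y lt1 t + (1 - 2 * z - s)) s.
  by rewrite avgE_lin avg_cst Y1; ring.
have -> : 2 * (mean Y - z) = 1 * mean Y + (mean Y - 2 * z) by ring.
apply: avg_le_affine => // a aY; have za := allP Yz _ aY.
have := markov_above (s + a.2) Y0 Y1 Yz.
have /andP[g0 g1] := avg_in01 (s + a.2) Y0 Y1 lt1_in01.
have : (a.2 - z) * (1 - avg Y lt1 (s + a.2)) <= a.2 - z.
  by rewrite -[leRHS]mulr1 ler_wpM2l ?subr_ge0// lerBlDr lerDl.
by move=> /=; lra.
Qed.

(* [p] and [q] stand for [P(Y < 1 - s)] and [P(Y1 + Y2 < 1 - s)]; the affine
   term on the right vanishes at [s = 3/5 n], an upper bound on the mean of [s]. *)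
Lemma two_layer_pointwise (n a s p q : R) :
  0 <= s -> 0 < n -> n <= a -> n <= 1 ->
  0 <= p <= 1 -> 0 <= q <= 1 -> (n <= 2 / 3) || (a <= 3 / 4) ->
  (a - s) * (1 - p) <= a - n -> (2 * a - 1 - s) * (1 - q) <= 2 * (a - n) ->
  n * (a <= s)%R%:R <= n / (a - 3 / 5 * n) * (s - 3 / 5 * n) + (p + 3 / 10 * q).
Proof.
move=> s0 n0 na n1 /andP[p0 p1] /andP[q0 q1] cases hp hq.
set D := a - 3 / 5 * n; have D0 : 0 < D by rewrite /D; lra.
have sub_le u : n * u <= D * (p + 3 / 10 * q) -> - (n / D * u) >= - (p + 3 / 10 * q).
  by move=> h; rewrite lerN2 mulrAC ler_pdivrMr// [leRHS]mulrC.
(* From [a] on, the affine term alone is at least [n]; between [3/5 n] and [a] the left side is 0;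
   below that, [e] measures how negative the affine term is. *)
have [as_|sa] := leP a s.
  rewrite mulr1 (@le_trans _ _ (n / D * D)) //; first by rewrite divfK ?gt_eqF.
  rewrite -[leLHS]addr0 lerD//; last lra.
  by rewrite ler_wpM2l ?divr_ge0//; rewrite /D; lra.
rewrite mulr0; have [es|se] := leP (3 / 5 * n) s.
  rewrite addr_ge0//; last lra.
  by rewrite mulr_ge0 ?subr_ge0// divr_ge0//; lra.
pose e := 3 / 5 * n - s; have e0 : 0 < e by rewrite /e; lra.
suff : n * e <= D * (p + 3 / 10 * q).
  by move=> /sub_le; rewrite /e -mulrN opprB; lra.
have aE : a = D + 3 / 5 * n by rewrite /D; ring.
have sE : s = 3 / 5 * n - e by rewrite /e; ring.
have hp' : 2 / 5 * n + e <= (D + e) * p.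
  by move: hp; rewrite aE sE; lra.
have De0 : 0 < D + e by lra.
have Dn : 2 / 5 * n <= D by rewrite /D; lra.
(* For [e] up to 2/5 the term in [p] suffices. *)
have [e25|e25] := leP e (2 / 5).
  suff : 0 <= (D + e) * (D * p - n * e) by rewrite pmulr_rge0// => ?; nra.
  have h1 : 0 <= D * ((D + e) * p - (2 / 5 * n + e)) by rewrite mulr_ge0//; lra.
  have h2 : 0 <= (D - 2 / 5 * n) * (2 / 5 * n + e * (1 - n)).
    by rewrite mulr_ge0//; [lra|rewrite addr_ge0//; [lra|rewrite mulr_ge0//; lra]].
  have h3 : 0 <= n * (2 / 5 * n + e) * (2 / 5 - e).
    by rewrite !mulr_ge0//; lra.
  nra.
(* As [s >= 0], [e] is at most [3/5 n], so here [n > 2/3]; then [cases] gives [a <= 3/4], hence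
   [e <= 9/20]. *)
have n23 : 2 / 3 < n by rewrite sE in s0; lra.
have a34 : a <= 3 / 4 by case/orP: cases => //; lra.
(* With 21/50, [3/10 * q] exceeds 1/8, the value of [5/2 * e - 1] at [e = 9/20]. *)
have q42 : 21 / 50 <= q.
  have : (2 * (a - n) + 17 / 60) * (1 - q) <= 2 * (a - n).
    by apply: le_trans hq; rewrite ler_wpM2r//; lra.
  by move=> h; nra.
have e45 : e <= 9 / 20 by lra.
suff h : 0 <= (D + e) * (D * p - n * e - D * (1 - 5 / 2 * e)).
  rewrite pmulr_rge0// in h.
  have : 0 <= D * (3 / 10 * q - (5 / 2 * e - 1)) by rewrite mulr_ge0//; lra.
  lra.
have h1 : 0 <= D * ((D + e) * p - (2 / 5 * n + e)) by rewrite mulr_ge0//; lra.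
have h2 : 0 <= (D - 2 / 5 * n) * (5 / 2 * e * (D + e) - D).
  by rewrite mulr_ge0//; [lra|nra].
nra.
Qed.

(** Averages [two_layer_pointwise], with [n = 1 - mean Y] and [a = 1 - z], over the sum of copies of
    Z; the bound on [j%:R * mean Z] makes the affine term nonpositive on average. *)
Lemma two_layer_bound Z Y z j : nneg Z -> mass Z = 1 -> nneg Y -> mass Y = 1 ->
  0 <= z -> all (fun a => z <= a.2) Y ->
  (1 / 4 <= z) || (1 / 3 <= mean Y) -> mean Y < 1 ->
  j%:R * mean Z <= 3 / 5 * (1 - mean Y) ->
  (1 - mean Y) * iter j (avg Z) (fun t => (1 - z <= t)%R%:R) 0 <=
  iter j (avg Z) (avg Y lt1) 0 + 3 / 10 * iter j (avg Z) (avg Y (avg Y lt1)) 0.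
Proof.
move=> Z0 Z1 Y0 Y1 z0 Yz zm m1 jZ.
set n := 1 - mean Y; have zY := mean_ge Y0 Y1 Yz.
have -> : n * iter j (avg Z) (fun t => (1 - z <= t)%R%:R) 0 =
   iter j (avg Z) (fun t => n * (1 - z <= t)%R%:R + 0) 0.
  by rewrite iter_avg_lin iter_avg_cst// addr0.
set D := 1 - z - 3 / 5 * n.
apply: (@le_trans _ _ (iter j (avg Z) (fun t => n / D * t +
   (1 * (3 / 10 * avg Y (avg Y lt1) t + avg Y lt1 t) + - (n / D * (3 / 5 * n)))) 0)).
  apply: ler_iter_avg => // t t0; rewrite addr0.
  have h1 := avg_in01 t Y0 Y1 lt1_in01.
  have h2 := avg_in01 t Y0 Y1 (fun u => avg_in01 u Y0 Y1 lt1_in01).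
  apply: (le_trans (@two_layer_pointwise n (1 - z) t _ _ _ _ _ _ h1 h2 _ _ _)) => //.
  - by rewrite /n; lra.
  - by rewrite /n; lra.
  - by rewrite /n; lra.
  - by case/orP: zm => ?; apply/orP; [right|left]; rewrite /n; lra.
  - by have := markov_above t Y0 Y1 Yz; rewrite /n; lra.
  - by have := markov_above2 t Y0 Y1 Yz; rewrite /n; lra.
  - rewrite -/D; lra.
rewrite iter_avg_lin iter_avg_id// iter_avg_lin iter_avg_lin iter_avg_cst//.
have : n / D * (j%:R * mean Z) <= n / D * (3 / 5 * n).
  by rewrite ler_wpM2l// divr_ge0// /D /n; lra.
lra.
Qed.

(** Markov's inequality for the square bounds both the tail on the left and the failure probability
    of Y + S < 1. The latter bound is made linear in the value of Y, so that only [mean Y] remains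
    after averaging. *)
Lemma second_moment_bound Z Y z j : nneg Z -> mass Z = 1 -> nneg Y -> mass Y = 1 ->
  0 <= z -> z <= 1 / 4 -> all (fun a => z <= a.2) Y -> all (fun a => a.2 <= z) Z ->
  mean Y <= 1 / 3 -> j%:R * mean Z <= 3 / 5 * (1 - mean Y) ->
  (1 - mean Y) * iter j (avg Z) (fun t => (1 - z <= t)%R%:R) 0 <=
  iter j (avg Z) (avg Y lt1) 0.
Proof.
move=> Z0 Z1 Y0 Y1 z0 z4 Yz Zz m3 jZ.
set n := 1 - mean Y; have zY := mean_ge Y0 Y1 Yz.
(* The bound of [iter_avg_sqr_le] at the largest allowed mean, [3/5 * n]. *)
pose C := (3 / 5 * z + 9 / 25 * n) * n.
have n23 : 2 / 3 <= n by rewrite /n; lra.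
have zn : z <= 1 - n by rewrite /n; lra.
have C0 : 0 <= C by rewrite mulr_ge0//; lra.
(* Needed at the very end, as [n * C <= n * n - C = (n + c) * (n - c)]. *)
have C1 : C * (1 + n) <= n * n.
  rewrite /C mulrAC ler_wpM2r//; first lra.
  by have [n34|n34] := leP n (3 / 4); nra.
pose c := Num.sqrt C.
have c0 : 0 <= c by rewrite sqrtr_ge0.
have cC : c * c = C by rewrite -expr2 sqr_sqrtr.
have cn : c <= n by nra.
pose a := 1 - z; have na : n <= a by rewrite /a; lra.
have m2 : iter j (avg Z) (fun t => t * t) 0 <= C.
  apply: le_trans (iter_avg_sqr_le j Z0 Z1 Zz) _.
  have -> : C = (3 / 5 * n) * (3 / 5 * n + z) by rewrite /C; field.
  have j0 : 0 <= j%:R * mean Z by rewrite mulr_ge0 ?mean_ge0.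
  by apply: ler_pM; rewrite -/n in jZ; lra.
have tail y : y < 1 -> (1 - y) ^+ 2 * iter j (avg Z) (fun t => (1 - y <= t)%R%:R) 0 <= C.
  move=> y1; apply: le_trans m2.
  rewrite (_ : _ * _ =
    iter j (avg Z) (fun t => (1 - y) ^+ 2 * (1 - y <= t)%R%:R + 0) 0); last first.
    by rewrite iter_avg_lin iter_avg_cst// addr0.
  apply: ler_iter_avg => // t t0; rewrite addr0.
  case: (leP (1 - y) t) => h /=; last by rewrite mulr0n mulr0 mulr_ge0.
  by rewrite mulr1n mulr1 expr2 ler_pM//; lra.
have a0 : 0 < a by lra.
have a20 : 0 < a ^+ 2 by rewrite exprn_gt0.
pose G y := iter j (avg Z) lt1 y.
have iter01 i y : 0 <= iter i (avg Z) lt1 y <= 1.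
  by elim: i y => [|i IH] y; [exact: lt1_in01|exact: avg_in01].
have G01 y : 0 <= G y <= 1 by exact: iter01.
have tailG y : iter j (avg Z) (fun t => (1 - y <= t)%R%:R) 0 = 1 - G y.
  rewrite /G -[y in RHS]add0r -iter_avg_shift.
  rewrite (_ : (fun t => (1 - y <= t)%R%:R) = fun t => -1 * lt1 (t + y) + 1).
    by rewrite iter_avg_lin iter_avg_cst//; ring.
  apply/funext => t; rewrite /lt1.
  by case: (leP (1 - y)) => h1; case: (ltP _ 1) => h2 /=; lra.
(* [C / (1 - y) ^ 2] is convex in [y], so up to the point [1 - c] where it
   reaches 1 it lies below its chord from [z]; this is linear in [y]. *)
have chord y : z <= y -> (a + c) * (1 - y - c) <= a ^+ 2 * G y.
  move=> zy; have /andP[g0 g1] := G01 y.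
  have [yc|yc] := leP (1 - c) y.
    by rewrite (@le_trans _ _ 0)//; [rewrite mulr_ge0_le0; lra|rewrite mulr_ge0// ltW].
  have y1 : y < 1 by lra.
  have := tail _ y1; rewrite tailG -cC => h.
  pose u := 1 - y; have uc : c < u by rewrite /u; lra.
  have ua : u <= a by rewrite /u /a; lra.
  have u0 : 0 < u ^+ 2 by rewrite exprn_gt0//; lra.
  rewrite -(ler_pM2l u0); rewrite -/u in h *.
  apply: (@le_trans _ _ (a ^+ 2 * ((u + c) * (u - c)))).
    have -> : u ^+ 2 * ((a + c) * (u - c)) = (u ^+ 2 * (a + c)) * (u - c) by ring.
    rewrite mulrA ler_wpM2r//; first lra.
    rewrite -subr_ge0 (_ : _ - _ = (a - u) * (a * u + c * (a + u))); last by ring.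
    by rewrite mulr_ge0//; [lra|rewrite addr_ge0// mulr_ge0//; lra].
  rewrite [leRHS]mulrCA ler_wpM2l//; first exact: ltW.
  by lra.
rewrite -iter_avgC -/n -/a.
have h1 : (a + c) * (n - c) <= a ^+ 2 * avg Y (iter j (avg Z) lt1) 0.
  have := @avg_le_affine Y (fun y => - a ^+ 2 * G y) (a + c) (- (a + c) * (1 - c)) 0 Y0 Y1.
  have -> : avg Y (fun y => - a ^+ 2 * G y) 0 = - a ^+ 2 * avg Y G 0.
    have := avgE_lin Y (- a ^+ 2) G (fun=> 0).
    move/(congr1 (@^~ 0)); rewrite avg_cst mulr0 addr0 => <-.
    by congr avg; apply/funext => t; rewrite addr0.
  move=> h; have {h} : - a ^+ 2 * avg Y G 0 <= (a + c) * mean Y + - (a + c) * (1 - c).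
    by apply: h => b bY; rewrite add0r; have := chord _ (allP Yz _ bY); lra.
  by rewrite /n -/G; lra.
have h2 : a ^+ 2 * iter j (avg Z) (fun t => (a <= t)%R%:R) 0 <= C by apply: tail; lra.
rewrite -(ler_pM2l a20); apply: le_trans h1.
rewrite mulrCA; apply: (@le_trans _ _ (n * C)); first by rewrite ler_wpM2l//; lra.
apply: (@le_trans _ _ ((n + c) * (n - c))); last by rewrite ler_wpM2r//; lra.
by lra.
Qed.

(** * Splitting a law at its top quantile *)

Definition scale (c : R) L := [seq (c * a.1, a.2) | a <- L].

Lemma avg_scale c L f s : avg (scale c L) f s = c * avg L f s.
Proof.
by rewrite /avg big_map mulr_sumr; apply: eq_bigr => a _; rewrite mulrA.
Qed.

Lemma mass_avg L : mass L = avg L (fun=> 1) 0.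
Proof. by rewrite avg_cst mulr1. Qed.

Lemma mean_avg L : mean L = avg L id 0.
Proof. by apply: eq_bigr => a _; rewrite add0r. Qed.

Lemma nneg_scale c L : 0 <= c -> nneg L -> nneg (scale c L).
Proof.
move=> c0 /allP L0; rewrite /nneg all_map; apply/allP => a /L0 /andP[a1 a2] /=.
by rewrite a2 mulr_ge0.
Qed.

(** Atoms go to Y from the largest value down until mass [x] is used up; the atom reaching that mass
    is cut in two at its value [z]. *)
Lemma split_sorted L (x : R) : sorted (fun a b : R * R => b.2 <= a.2) L ->
  nneg L -> 0 < x <= mass L ->
  exists z Y Z, [/\ z \in [seq a.2 | a <- L], nneg Y /\ nneg Z, mass Y = x,
    all (fun a => z <= a.2) Y /\ all (fun a => a.2 <= z) Z &
    forall f s, avg L f s = avg Y f s + avg Z f s].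
Proof.
elim: L x => [|[p w] L IH] x.
  by rewrite /mass big_nil => _ _ /andP[x0 /(lt_le_trans x0)]; rewrite ltxx.
move=> Lsorted /= /andP[/andP[p0 w0] L0] /andP[x0]; rewrite /mass big_cons /= => xL.
have Lw : all (fun a => a.2 <= w) L.
  by apply: (order_path_min _ Lsorted) => a b c /= ab bc; exact: le_trans bc ab.
have [xp|px] := leP x p.
  exists w, [:: (x, w)], ((p - x, w) :: L); split.
  - by rewrite inE eqxx.
  - by rewrite /= w0 (ltW x0) subr_ge0 xp.
  - by rewrite big_seq1.
  - by rewrite /= lexx.
  - by move=> f s; rewrite /avg !big_cons big_nil /=; ring.
have [//||z [Y [Z [zL [Y0 Z0] Yx [Yz Zz] avgL]]]] := IH (x - p) (path_sorted Lsorted).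
  by rewrite subr_gt0 px lerBlDl.
exists z, ((p, w) :: Y), Z; split => //.
- by rewrite inE zL orbT.
- by rewrite /= p0 w0.
- by rewrite /mass big_cons [X in _ + X]Yx /=; ring.
- by split=> //=; rewrite Yz andbT; case/mapP: zL => a /(allP Lw) aw ->.
- by move=> f s; rewrite /avg !big_cons -!/(avg _ _ _) avgL addrA.
Qed.

Lemma split_law L (x : R) : nneg L -> mass L = 1 -> 0 < x < 1 ->
  exists z Y Z, [/\ 0 <= z, nneg Y /\ nneg Z, mass Y = 1 /\ mass Z = 1,
    all (fun a => z <= a.2) Y /\ all (fun a => a.2 <= z) Z &
    forall f s, avg L f s = x * avg Y f s + (1 - x) * avg Z f s].
Proof.
move=> L0 L1 /andP[x0 x1].
pose L' := sort (fun a b : R * R => b.2 <= a.2) L.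
have avgL' f s : avg L f s = avg L' f s by apply: perm_big; rewrite perm_sym perm_sort.
have L'0 : nneg L' by rewrite /nneg all_sort.
have [| //||z [Y [Z [zL' [Y0 Z0] Yx [Yz Zz] avgE]]]] := @split_sorted L' x.
- by apply: sort_sorted => a b; exact: le_total.
- by rewrite x0 mass_avg -avgL' -mass_avg L1 ltW.
have Z1 : mass Z = 1 - x.
  by rewrite -L1 -Yx (mass_avg L) avgL' avgE -!mass_avg addrC addKr.
have x10 : 0 < 1 - x by lra.
exists z, (scale x^-1 Y), (scale (1 - x)^-1 Z); split.
- by case/mapP: zL' => a /(allP L'0)/andP[_ ?] ->.
- by rewrite !nneg_scale// invr_ge0 ltW.
- by split; rewrite mass_avg avg_scale -mass_avg ?Yx ?Z1 mulVf ?gt_eqF.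
- by rewrite !all_map.
- by move=> f s; rewrite !avg_scale avgL' avgE !mulVKf ?gt_eqF.
Qed.

(** Binomial expansion in the number of copies drawn from Y, truncated after two; the dropped terms
    are nonnegative. The induction draws one more copy and uses Pascal's rule; [step1] and [step2]
    are the truncations after zero and one. *)
Lemma iter_avg_mixture L Y Z (x : R) f j s : nneg L -> nneg Y -> nneg Z ->
  0 <= x <= 1 -> (forall g s, avg L g s = x * avg Y g s + (1 - x) * avg Z g s) ->
  (forall t, 0 <= f t) ->
  (1 - x) ^+ j.+2 * iter j.+2 (avg Z) f s +
  j.+2%:R * x * (1 - x) ^+ j.+1 * iter j.+1 (avg Z) (avg Y f) s +
  j.+2%:R * j.+1%:R / 2 * x ^+ 2 * (1 - x) ^+ j * iter j (avg Z) (avg Y (avg Y f)) s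
  <= iter j.+2 (avg L) f s.
Proof.
move=> L0 Y0 Z0 /andP[x0 x1] avgL f0.
have scal M c g t : avg M (fun u => c * g u) t = c * avg M g t.
  by rewrite /avg mulr_sumr; apply: eq_bigr => a _; ring.
have add M g h t : avg M (fun u => g u + h u) t = avg M g t + avg M h t.
  by rewrite /avg -big_split; apply: eq_bigr => a _; rewrite mulrDr.
have x10 : 0 <= 1 - x by rewrite subr_ge0.
pose b := 1 - x.
have step1 i t : b ^+ i * iter i (avg Z) f t <= iter i (avg L) f t.
  elim: i t => [|i IH] t; first by rewrite mul1r.
  rewrite [iter _ (avg L) _]iterS avgL.
  have h0 : 0 <= x * avg Y (iter i (avg L) f) t.
    by rewrite mulr_ge0// (@iter_avg_ge0 Y 1)// => u _; apply: iter_avg_ge0.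
  have : b * avg Z (fun u => b ^+ i * iter i (avg Z) f u) t <= b * avg Z (iter i (avg L) f) t.
    by rewrite ler_wpM2l// ler_avg.
  by rewrite scal exprS /= /b; lra.
have step2 i t : b ^+ i.+1 * iter i.+1 (avg Z) f t +
    i.+1%:R * x * b ^+ i * iter i (avg Z) (avg Y f) t <= iter i.+1 (avg L) f t.
  elim: i t => [|i IH] t; first by rewrite /= avgL /b; lra.
  rewrite [iter _ (avg L) _]iterS avgL.
  have h1 : b * avg Z (fun u => b ^+ i.+1 * iter i.+1 (avg Z) f u +
    i.+1%:R * x * b ^+ i * iter i (avg Z) (avg Y f) u) t <= b * avg Z (iter i.+1 (avg L) f) t.
    by rewrite ler_wpM2l// ler_avg.
  have h2 : x * avg Y (fun u => b ^+ i.+1 * iter i.+1 (avg Z) f u) t <=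
      x * avg Y (iter i.+1 (avg L) f) t.
    by rewrite ler_wpM2l// ler_avg.
  move: h1 h2; rewrite add !scal !(iter_avgC Z) -!iterSr -/b => h1 h2.
  rewrite -[i.+2]addn1 natrD exprD expr1 [b ^+ i.+1]exprS.
  rewrite [b ^+ i.+1]exprS in h1 h2.
  by rewrite addn1; lra.
elim: j s => [|j IH] t.
  rewrite /= avgL.
  rewrite (_ : avg L f = fun t => x * avg Y f t + (1 - x) * avg Z f t); last first.
    by apply/funext => u; rewrite avgL.
  by rewrite !add !scal (avgC Y Z) !expr2; lra.
rewrite [iter _ (avg L) _]iterS avgL.
have := IH; rewrite -/b => {}IH.
have h1 : b * avg Z (fun s => b ^+ j.+2 * iter j.+2 (avg Z) f s +
  j.+2%:R * x * b ^+ j.+1 * iter j.+1 (avg Z) (avg Y f) s +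
  j.+2%:R * j.+1%:R / 2 * x ^+ 2 * b ^+ j * iter j (avg Z) (avg Y (avg Y f)) s) t
  <= b * avg Z (iter j.+2 (avg L) f) t.
  by rewrite ler_wpM2l// ler_avg.
have h2 : x * avg Y (fun u => b ^+ j.+2 * iter j.+2 (avg Z) f u +
    j.+2%:R * x * b ^+ j.+1 * iter j.+1 (avg Z) (avg Y f) u) t <=
    x * avg Y (iter j.+2 (avg L) f) t.
  by rewrite ler_wpM2l// ler_avg.
move: h1 h2; rewrite !add !scal !(iter_avgC Z) -!iterSr -/b => h1 h2.
rewrite !exprS in h1 h2 *; rewrite -[j.+3%:R]natr1 -[j.+2%:R]natr1 in h1 h2 *.
lra.
Qed.

(** On the event the sum is at least 1, so it may be inserted as a factor; size biasing singles out
    one copy, and bounding that copy by [z] inside the event decouples it from the rest. *)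
Lemma size_biased_markov Z z j : nneg Z -> all (fun a => a.2 <= z) Z ->
  iter j.+1 (avg Z) (fun t => (1 <= t)%R%:R) 0 <=
  j.+1%:R * mean Z * iter j (avg Z) (fun t => (1 - z <= t)%R%:R) 0.
Proof.
move=> Z0 Zz; set h := fun t : R => (1 <= t)%R%:R.
have h0 t : 0 <= h t by exact: ler0n.
apply: (@le_trans _ _ (iter j.+1 (avg Z) (fun t => t * h t) 0)).
  apply: ler_iter_avg => // t t0; rewrite /h; case: (leP 1 t) => /= t1.
    by rewrite mulr1.
  by rewrite mulr0.
rewrite iter_avg_id_mul mul0r add0r -mulrA ler_wpM2l// iter_avgC.
set g := fun t : R => (1 - z <= t)%R%:R.
have -> : mean Z * iter j (avg Z) g 0 = iter j (avg Z) (fun t => mean Z * g t + 0) 0.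
  rewrite iter_avg_lin; suff -> u : iter j (avg Z) (fun=> 0) u = 0 by rewrite addr0.
  by elim: (j) u => //= i IH u; rewrite /avg big1// => a _; rewrite IH mulr0.
apply: ler_iter_avg => // t t0; rewrite addr0 -mass_size_bias -(avg_cst _ _ t).
rewrite /avg 2!big_seq; apply: ler_sum => a aZ.
have /allP/(_ _ aZ)/andP[a1 _] := nneg_size_bias Z0.
rewrite ler_wpM2l// /h /g ler_nat; case/mapP: aZ => b /(allP Zz) bz ->/=.
by case: (leP 1 (t + b.2)) => // h1; rewrite (_ : 1 - z <= t)//; lra.
Qed.

(** * Tail bounds for finitely supported laws *)

Lemma iter_avg_lt1E L j : mass L = 1 ->
  iter j (avg L) lt1 0 = 1 - iter j (avg L) (fun t => (1 <= t)%R%:R) 0.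
Proof.
move=> L1; rewrite (_ : lt1 = fun t : R => -1 * (1 <= t)%R%:R + 1).
  by rewrite iter_avg_lin iter_avg_cst//; ring.
by apply/funext => t; rewrite /lt1; case: (leP 1 t) => /= _; ring.
Qed.

Lemma ler_avg_arg L f s t : nneg L -> (forall s t, s <= t -> f t <= f s) ->
  s <= t -> avg L f t <= avg L f s.
Proof.
move=> /allP L0 fdec st; rewrite /avg 2!big_seq; apply: ler_sum => a /L0 /andP[a1 _].
by rewrite ler_wpM2l// fdec// lerD2r.
Qed.

Lemma finite_tail_critical L k (x : R) : (1 < k)%N -> x = 3 / (5 * k%:R - 2) ->
  nneg L -> mass L = 1 -> mean L <= x -> (1 - x) ^+ k <= iter k (avg L) lt1 0.
Proof.
case: k => [|[|j]]// _ xE L0 L1 Lx.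
have j0 : 0 <= j%:R :> R by [].
have jE : j.+2%:R = j%:R + 2 :> R by rewrite -addn2 natrD.
have kx : 5 * j%:R * x + 8 * x = 3.
  by rewrite xE jE; field; lra.
have x0 : 0 < x by rewrite xE jE divr_gt0//; lra.
have x1 : x < 1 by nra.
have [z [Y [Z [z0 [Y0 Z0] [Y1 Z1] [Yz Zz] avgL]]]] := split_law L0 L1 (introT andP (conj x0 x1)).
have x01 : 0 <= x <= 1 by rewrite !ltW.
apply: le_trans (iter_avg_mixture j 0 L0 Y0 Z0 x01 avgL lt1_ge0).
rewrite iter_avg_lt1E//.
have mb := size_biased_markov j.+1 Z0 Zz.
set P := iter j.+1 (avg Z) (fun t => (1 - z <= t)%R%:R) 0 in mb.
set Q := iter j.+2 (avg Z) _ 0 in mb *.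
set A1 := iter j.+1 (avg Z) _ 0; set A2 := iter j (avg Z) _ 0.
have P0 : 0 <= P by apply: iter_avg_ge0.
have A10 : 0 <= A1.
  by apply: iter_avg_ge0 => // t _; case/andP: (avg_in01 t Y0 Y1 lt1_in01).
have YY01 t := avg_in01 t Y0 Y1 (fun u => avg_in01 u Y0 Y1 lt1_in01).
have A20 : 0 <= A2 by apply: iter_avg_ge0 => // t _; case/andP: (YY01 t).
have meanL : x * mean Y + (1 - x) * mean Z <= x.
  by rewrite !mean_avg -avgL -mean_avg.
(* The second-order term of the expansion has one copy of Z fewer; dropping a nonnegative copy only
   raises the probability of staying below 1. *)
have A2le : iter j.+1 (avg Z) (avg Y (avg Y lt1)) 0 <= A2.
  rewrite iterSr; apply: ler_iter_avg => // t t0.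
  rewrite -[leRHS](@iter_avg_cst Z 1 _ t)//=; apply: ler_avg => // u tu.
  by do !apply: ler_avg_arg => // *; exact: ler_lt1.
(* The extreme [x] satisfies [(k - 1) x = 3/5 (1 - x)], which turns the constraint [meanL] into this
   one. *)
have jZ : j.+1%:R * mean Z <= 3 / 5 * (1 - mean Y).
  have jx : j.+1%:R * x = 3 / 5 * (1 - x) by rewrite -natr1; lra.
  rewrite -(ler_pM2l x0) mulrA [x * _]mulrC jx; lra.
have main : (1 - mean Y) * P <= A1 + 3 / 10 * A2.
  have [m1|m1] := leP 1 (mean Y).
    by rewrite (@le_trans _ _ 0)// ?mulr_le0_ge0//; lra.
  have [zm|] := boolP ((1 / 4 <= z) || (1 / 3 <= mean Y)).
    by have := two_layer_bound Z0 Z1 Y0 Y1 z0 Yz zm m1 jZ; rewrite -/P -/A1; lra.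
  rewrite negb_or -!ltNge => /andP[/ltW z4 /ltW m3].
  by have := second_moment_bound Z0 Z1 Y0 Y1 z0 z4 Yz Zz m3 jZ; rewrite -/P -/A1; lra.
set b := 1 - x.
have b0 : 0 <= b by rewrite subr_ge0 ltW.
have jx : j.+1%:R * x = 3 / 5 * b by rewrite -natr1 /b; lra.
(* The same relation turns [(k - 1) / 2 * x] into [3/10 * (1 - x)], the origin of the weight
   3/10. *)
rewrite (_ : j.+2%:R * j.+1%:R / 2 * x ^+ 2 * b ^+ j * A2 =
   j.+2%:R * b ^+ j * (3 / 10 * b * x * A2)); last first.
  by transitivity (j.+2%:R * b ^+ j * ((j.+1%:R * x) / 2 * x * A2)); [ring|rewrite jx; field].
have h1 : b * (b * mean Z * P) <= b * (x * (1 - mean Y) * P).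
  by rewrite ler_wpM2l// ler_wpM2r// /b; lra.
have h2 : b * x * ((1 - mean Y) * P) <= b * x * (A1 + 3 / 10 * A2).
  by rewrite ler_wpM2l// mulr_ge0// ltW.
have h3 : 0 <= j.+2%:R * b ^+ j * (b * x * A1 + 3 / 10 * b * x * A2 - b * (b * mean Z * P)).
  by rewrite !mulr_ge0 ?exprn_ge0//; lra.
have h4 : b ^+ j.+2 * Q <= b ^+ j.+2 * (j.+2%:R * mean Z * P) by rewrite ler_wpM2l ?exprn_ge0.
rewrite !exprS in h4 *; lra.
Qed.

Lemma finite_tail_le L k (x : R) : (0 < k)%N -> 0 <= x <= 3 / (5 * k%:R - 2) ->
  nneg L -> mass L = 1 -> mean L <= x ->
  iter k (avg L) (fun t => (1 <= t)%R%:R) 0 <= 1 - (1 - x) ^+ k.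
Proof.
move=> k0 /andP[x0 xk] L0 L1 Lx.
suff : (1 - x) ^+ k <= iter k (avg L) lt1 0 by rewrite iter_avg_lt1E//; lra.
(* For [k = 1] this is Markov's inequality. *)
have [k1|k1] := leqP k 1.
  have {k0 k1 xk} -> : k = 1%N by case: k k0 k1 {xk} => [|[]].
  rewrite expr1 /=.
  have := @avg_le_affine L (fun t => -1 * lt1 t + 1) 1 0 0 L0 L1.
  rewrite avgE_lin avg_cst L1 => H.
  suff : -1 * avg L lt1 0 + 1 * 1 <= 1 * mean L + 0 by lra.
  apply: H => a /(allP L0)/andP[_ a2]; rewrite /lt1 add0r.
  by case: (ltP a.2) => /= h; lra.
set x' := 3 / (5 * k%:R - 2) in xk.
have k2 : 2 <= k%:R :> R by rewrite ler_nat.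
have x'1 : x' < 1 by rewrite ltr_pdivrMr; lra.
have x1 : 0 < 1 - x by lra.
(* Mixing with an atom at 1 raises the mean from [x] to the extreme value [x']
     and multiplies both sides by the same factor. *)
pose c := (1 - x') / (1 - x).
have c0 : 0 < c by rewrite divr_gt0// subr_gt0.
have cx : c * (1 - x) = 1 - x' by rewrite divfK ?gt_eqF.
have c1 : c <= 1 by rewrite ler_pdivrMr//; lra.
pose L' := (1 - c, 1) :: scale c L.
have avgL' f s : avg L' f s = (1 - c) * f (s + 1) + c * avg L f s.
  by rewrite /avg big_cons -!/(avg _ _ _) avg_scale.
have key : (1 - x') ^+ k <= iter k (avg L') lt1 0.
  apply: finite_tail_critical => //.
  - by rewrite /= nneg_scale ?(ltW c0)// subr_ge0 c1 ler01.
  - by rewrite mass_avg avgL' -mass_avg L1; ring.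
  - rewrite mean_avg avgL' -mean_avg; nra.
(* Drawing the atom at 1 already leaves the event, so each copy contributes exactly a factor [c]. *)
have itE j t : 0 <= t -> iter j (avg L') lt1 t = c ^+ j * iter j (avg L) lt1 t.
  elim: j t => [|j IH] t t0; first by rewrite mul1r.
  rewrite [iter _ (avg L') _]iterS avgL' IH ?addr_ge0//.
  have -> : iter j (avg L) lt1 (t + 1) = 0.
    have le0 : iter j (avg L) lt1 (t + 1) <= iter j (avg L) (fun=> 0) (t + 1).
      by apply: ler_iter_avg => // u tu; rewrite /lt1; case: (ltP u 1) => //=; lra.
    apply/eqP; rewrite eq_le (le_trans le0) ?iter_avg_cst//=.
    by apply: iter_avg_ge0 => // u _; exact: lt1_ge0.
  rewrite !mulr0 add0r exprS -mulrA; congr (_ * _).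
  rewrite /= /avg mulr_sumr 2!big_seq; apply: eq_bigr => a /(allP L0)/andP[_ a2].
  by rewrite IH ?addr_ge0// mulrCA.
by move: key; rewrite itE// -cx exprMn ler_pM2l// exprn_gt0.
Qed.

(** Each copy is kept with probability [c] and otherwise set to 0; all [k] survive with probability
    [c ^+ k]. This absorbs the slight increase of the mean caused by discretisation. *)
Lemma thinned_tail_le L k (x c : R) : (0 < k)%N -> 0 <= x <= 3 / (5 * k%:R - 2) ->
  nneg L -> mass L = 1 -> 0 <= c <= 1 -> c * mean L <= x ->
  c ^+ k * iter k (avg L) (fun t => (1 <= t)%R%:R) 0 <= 1 - (1 - x) ^+ k.
Proof.
move=> k0 xk L0 L1 /andP[c0 c1] Lx.
pose L' := (1 - c, 0) :: scale c L.
have avgL' f s : avg L' f s = (1 - c) * f s + c * avg L f s.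
  by rewrite /avg big_cons -!/(avg _ _ _) avg_scale addr0.
have L'0 : nneg L' by rewrite /= nneg_scale// subr_ge0 c1 lexx.
apply: le_trans (@finite_tail_le L' k x k0 xk L'0 _ _).
- elim: k 0 {k0 xk} => [|j IH] s; first by rewrite mul1r.
  rewrite [iter _ (avg L') _]iterS avgL' -[leLHS]add0r lerD//.
    by rewrite mulr_ge0 ?subr_ge0// iter_avg_ge0.
  rewrite exprS -mulrA ler_wpM2l// /= /avg mulr_sumr 2!big_seq.
  apply: ler_sum => a /(allP L0)/andP[a1 _].
  by rewrite mulrCA ler_wpM2l.
- by rewrite mass_avg avgL' -mass_avg L1; ring.
- by rewrite mean_avg avgL' -mean_avg; lra.
Qed.

End FiniteLaws.

(** * Discretisation of random variables *)

Section Discretisation.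
Local Open Scope classical_set_scope.
Context {R : realType}.

(** Brings iterated averages into the form in which the joint law of the rounded variables appears;
    the induction peels off the first coordinate. *)
Lemma iter_avg_ffun (T : finType) (p v : T -> R) (h : R -> R) k s :
  iter k (avg [seq (p t, v t) | t <- index_enum T]) h s =
  \sum_(f : {ffun 'I_k -> T}) (\prod_i p (f i)) * h (s + \sum_i v (f i)).
Proof.
elim: k s => [|k IH] s.
  pose f0 : {ffun 'I_0 -> T} := ffun0 (card_ord 0).
  rewrite (big_pred1 f0) => [|f]; first by rewrite !big_ord0 mul1r addr0.
  by apply/esym/eqP/ffunP => -[].
pose cons_ffun (u : T * {ffun 'I_k -> T}) : {ffun 'I_k.+1 -> T} :=
  [ffun i => oapp u.2 u.1 (unlift ord0 i)].
pose uncons_ffun (f : {ffun 'I_k.+1 -> T}) := (f ord0, [ffun i => f (lift ord0 i)]).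
rewrite (reindex cons_ffun) /=; last first.
  exists uncons_ffun => [[t f] _|f _].
    congr pair; first by rewrite ffunE unlift_none.
    by apply/ffunP => i; rewrite !ffunE liftK.
  apply/ffunP => i; rewrite !ffunE; case: unliftP => [j ->|->] //=.
  by rewrite ffunE.
rewrite /avg big_map.
rewrite (eq_bigr (fun t => \sum_(f : {ffun 'I_k -> T}) p t *
   (\prod_i p (f i) * h (s + v t + \sum_i v (f i))))); last first.
  by move=> t _; rewrite -mulr_sumr IH.
rewrite pair_bigA /=; apply: eq_bigr => -[t f] _ /=.
rewrite !big_ord_recl !ffunE unlift_none /= mulrA addrA; congr (_ * _ * h (_ + _)).
  by apply: eq_bigr => i _; rewrite ffunE liftK.
by apply: eq_bigr => i _; rewrite ffunE liftK.
Qed.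

Context {d : measure_display} {W : measurableType d} (P : probability W R).

Lemma finite_range_indic (T : finType) (J : W -> T) (g : T -> R) w :
  g (J w) = \sum_t g t * \1_(J @^-1` [set t]) w.
Proof.
rewrite (bigD1 (J w))//= big1 ?addr0 => [|t tJ].
  by rewrite indicE mem_set// mulr1.
by rewrite indicE memNset ?mulr0// => /= Jt; rewrite Jt eqxx in tJ.
Qed.

Lemma measurable_finite_range (T : finType) (J : W -> T) (g : T -> R) :
  (forall t, measurable (J @^-1` [set t])) ->
  measurable_fun setT (fun w => g (J w)).
Proof.
move=> mJ; rewrite (_ : (fun w => _) =
    fun w => \sum_t g t * \1_(J @^-1` [set t]) w); last first.
  by apply/funext => w; exact: finite_range_indic.
by apply: measurable_sum => t; apply: measurable_funM => //; exact: measurable_indic.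
Qed.

Lemma integral_finite_range (T : finType) (J : W -> T) (g : T -> R) :
  (forall t, measurable (J @^-1` [set t])) -> (forall t, 0 <= g t) ->
  (\int[P]_w (g (J w))%:E = \sum_t (g t)%:E * P (J @^-1` [set t]))%E.
Proof.
move=> mJ g0.
under eq_integral do rewrite finite_range_indic -sumEFin.
rewrite ge0_integral_sum//; last first.
- by move=> t w _; rewrite lee_fin mulr_ge0.
- by move=> t; apply/measurable_EFinP; apply: measurable_funM => //; exact: measurable_indic.
apply: eq_bigr => t _; under eq_integral do rewrite EFinM.
rewrite ge0_integralZl_EFin//.
- by rewrite integral_indic// setIT.
- by apply/measurable_EFinP; exact: measurable_indic.
Qed.

Variables (k : nat) (x : R) (X : 'I_k -> {RV P >-> R}).
Hypotheses (k0 : (0 < k)%N) (xk : 0 <= x <= 3 / (5 * k%:R - 2)).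
Hypotheses (X0 : forall i w, 0 <= X i w) (Xind : mutually_independent X)
  (Xid : identically_distributed X) (EX : forall i, ('E_P[X i] = x%:E)%E).

(** Rounding variables below 1 down to multiples of 1/N costs the sum at most k/N; enlarging the
    values by N/(N - k) makes up for it, and thinning by the inverse factor brings the mean back to
    at most [x]. *)
Lemma discretised_tail_le N : (k < N)%N ->
  (1 - k%:R / N%:R) ^+ k * fine (P [set w | 1 <= \sum_(i < k) X i w]) <=
  1 - (1 - x) ^+ k.
Proof.
move=> kN; have N0 : 0 < N%:R :> R by rewrite ltr0n (leq_trans _ kN).
have kNR : 0 < N%:R - k%:R :> R by rewrite subr_gt0 ltr_nat.
(* Capping at [N] keeps the range finite and loses no event: index [N] alone has value
   [N / (N - k) >= 1]. *)
pose idx (r : R) : 'I_N.+1 := inord (minn (Num.truncn (N%:R * r)) N).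
have idxE r : idx r = minn (Num.truncn (N%:R * r)) N :> nat.
  by rewrite inordK// ltnS geq_minr.
have midx j : measurable (idx @^-1` [set j]).
  have mi : measurable_fun setT (fun r => (idx r)%:R : R).
    apply: nondecreasing_measurable => // r s rs; rewrite ler_nat !idxE.
    by rewrite leq_min geq_minr andbT geq_min le_truncn// ler_wpM2l// ltW.
  rewrite (_ : _ @^-1` _ = setT `&` (fun r => (idx r)%:R : R) @^-1` [set j%:R]).
    exact: mi.
  rewrite setTI; apply/seteqP; split => r /= => [->//|/eqP].
  by rewrite eqr_nat => /eqP /val_inj.
have midxX i j : measurable ((idx \o X i) @^-1` [set j]).
  rewrite comp_preimage -[X in measurable X]setTI.
  exact: (measurable_funP (X i)).
pose i0 : 'I_k := Ordinal k0.
pose p j := fine (P ((idx \o X i0) @^-1` [set j])).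
have pE i j : P ((idx \o X i) @^-1` [set j]) = (p j)%:E.
  rewrite /p fineK; last exact: (fin_num_measure P).
  exact: (Xid i i0 (midx j)).
have p0 j : 0 <= p j by exact: fine_ge0.
pose v (j : 'I_N.+1) : R := j%:R / (N%:R - k%:R).
pose L := [seq (p j, v j) | j <- index_enum 'I_N.+1].
have L0 : nneg L by apply/allP => _ /mapP[j _ ->]; rewrite /= p0 divr_ge0// ltW.
have L1 : mass L = 1.
  apply: EFin_inj; rewrite /mass big_map -sumEFin.
  under eq_bigr => j _ do rewrite -[_%:E]mul1e -(pE i0).
  rewrite -(@integral_finite_range _ _ (fun=> 1))//.
  by rewrite (integral_cst P measurableT) mul1e; exact: probability_setT.
pose S (f : {ffun 'I_k -> 'I_N.+1}) := \sum_i v (f i).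
pose J w := [ffun i => idx (X i w)].
have JE f : J @^-1` [set f] =
    \bigcap_(i in [set i | i \in [set: 'I_k]%SET]) (X i @^-1` (idx @^-1` [set f i])).
  apply/seteqP; split => w /=.
    by move=> <- i _ /=; rewrite ffunE.
  by move=> h; apply/ffunP => i; rewrite ffunE; apply: h; rewrite /= inE.
have PJ f : P (J @^-1` [set f]) = (\prod_i p (f i))%:E.
  rewrite JE Xind// -prodEFin big_mkcond /=.
  by apply: eq_bigr => i _; rewrite inE -(pE i).
have mJ f : measurable (J @^-1` [set f]).
  by rewrite JE; apply: fin_bigcap_measurable => [|i _]; [exact: finite_finset|exact: midxX].
have lower r : (idx r)%:R <= N%:R * r \/ r < 0.
  have [r0|] := leP 0 r; [left|by right].
  apply: (@le_trans _ _ (Num.truncn (N%:R * r))%:R).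
    by rewrite ler_nat idxE geq_minl.
  by rewrite truncn_le mulr_ge0// ltW.
have tail_sub w : 1 <= \sum_(i < k) X i w -> 1 <= S (J w).
  move=> Xw; rewrite /S -mulr_suml ler_pdivlMr// mul1r.
  have [[i Xi]|/forallNP Xlt] := pselect (exists i, N%:R <= N%:R * X i w).
    rewrite (bigD1 i)//= ffunE idxE (minn_idPr _); last first.
      by have := le_truncn Xi; rewrite natrK.
    by rewrite lerD2l (@le_trans _ _ 0) ?oppr_le0 ?sumr_ge0.
  (* With no cap active each index exceeds [N X_i - 1], so the indices add up to at least
     [N - k]. *)
  apply: (@le_trans _ _ (\sum_(i < k) (N%:R * X i w - 1))).
    rewrite sumrB -mulr_sumr sumr_const card_ord lerB//.
    by rewrite -[leLHS]mulr1 ler_wpM2l// ltW.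
  apply: ler_sum => i _; rewrite ffunE idxE.
  have := Xlt i => /negP; rewrite -ltNge => XiN.
  rewrite (minn_idPl _); first by rewrite lerBlDr natr1 ltW// truncnS_gt.
  by rewrite -ltnS truncn_lt_nat ?(lt_trans XiN) ?ltr_nat// mulr_ge0// ltW.
have PT : fine (P [set w | 1 <= \sum_(i < k) X i w]) <=
    iter k (avg L) (fun t => (1 <= t)%R%:R) 0.
  have mE : measurable [set w | 1 <= \sum_(i < k) X i w].
    rewrite (_ : [set w | _] = setT `&` (fun w => \sum_(i < k) X i w) @^-1` `[1, +oo[).
      by apply: measurable_sum => // i; exact: measurable_funP.
    by rewrite setTI; apply/seteqP; split => w /=; rewrite in_itv /= andbT.
  rewrite -lee_fin fineK ?fin_num_measure// iter_avg_ffun -sumEFin.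
  under eq_bigr do rewrite add0r mulrC EFinM -PJ.
  rewrite -(@integral_finite_range _ J (fun f => (1 <= S f)%R%:R))//.
  rewrite -[X in (P X <= _)%E]setIT -integral_indic//.
  apply: ge0_le_integral => //.
  - by apply/measurable_EFinP; exact: measurable_indic.
  - by apply/measurable_EFinP; exact: (@measurable_finite_range _ J (fun f => (1 <= S f)%R%:R : R)).
  move=> w _; rewrite lee_fin indicE ler_nat.
  by have [/set_mem/tail_sub ->|] := boolP (w \in [set w | 1 <= \sum_(i < k) X i w]).
pose c : R := 1 - k%:R / N%:R.
have cE : c = (N%:R - k%:R) / N%:R by rewrite /c mulrBl divff ?gt_eqF.
have c0 : 0 < c by rewrite cE divr_gt0.
have c1 : c <= 1 by rewrite /c gerBl divr_ge0.
apply: (@le_trans _ _ (c ^+ k * iter k (avg L) (fun t => (1 <= t)%R%:R) 0)).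
  by rewrite ler_wpM2l// exprn_ge0// ltW.
apply: thinned_tail_le => //; first by rewrite (ltW c0) c1.
(* [c * v j] equals [j / N], which is at most the original variable. *)
rewrite -lee_fin -(EX i0) expectation_def /mean big_map mulr_sumr -sumEFin.
apply: (@le_trans _ _ (\int[P]_w ((idx (X i0 w))%:R / N%:R)%:E)%E).
  rewrite (@integral_finite_range _ (idx \o X i0) (fun j => j%:R / N%:R))//.
  apply: lee_sum => j _; rewrite (pE i0) -EFinM lee_fin /v cE /=; move: (p j) => q.
  rewrite [leLHS](_ : _ = j%:R / N%:R * q)//.
  by field; rewrite -/(N%:R - k%:R) !gt_eqF.
apply: ge0_le_integral => //.
- by apply/measurable_EFinP; exact: (@measurable_finite_range _ (idx \o X i0) (fun j => j%:R / N%:R)).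
- by apply/measurable_EFinP; exact: measurable_funP.
- move=> w _; rewrite lee_fin ler_pdivrMr// mulrC.
  by have [//|] := lower (X i0 w); rewrite ltNge X0.
Qed.

End Discretisation.

(** * Bernoulli variables *)

Section BernoulliProduct.
Local Open Scope classical_set_scope.
Context {R : realType} (k : nat) (x : R) (x01 : 0 <= x <= 1).

Local Notation bits := {ffun 'I_k -> bool}.

Definition bit_weight (b : bool) : R := if b then x else 1 - x.

Lemma bit_weight_ge0 b : 0 <= bit_weight b.
Proof. by case/andP: x01 => x0 x1; case: b => //=; rewrite subr_ge0. Qed.

Definition bits_weight (f : bits) : R := \prod_i bit_weight (f i).

Lemma bits_weight_ge0 f : 0 <= bits_weight f.
Proof. by apply: prodr_ge0 => i _; exact: bit_weight_ge0. Qed.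

(** Numbers past the enumeration decode to the all-false vector; they will carry no mass. *)
Definition bits_of_nat (n : nat) : bits := nth [ffun=> false] (enum bits) n.

(* The sample space is [nat] (all of whose subsets are measurable), its first
   [2 ^ k] points encoding the bit vectors. *)
Definition bernoulli_product : set nat -> \bar R :=
  msum (fun n => mscale (NngNum (bits_weight_ge0 (bits_of_nat n))) (dirac n)) #|bits|.

HB.instance Definition _ := Measure.on bernoulli_product.

Lemma bernoulli_productE (B : pred bits) :
  bernoulli_product [set n | B (bits_of_nat n)] =
  (\sum_(f : bits | B f) bits_weight f)%:E.
Proof.
rewrite /bernoulli_product /msum.
transitivity (\sum_(i < #|bits|) (bits_weight (enum_val i) * (B (enum_val i))%:R)%:E)%E.
  apply: eq_bigr => i _; rewrite /= /mscale /= diracE EFinM.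
  have -> : bits_of_nat i = enum_val i by rewrite /bits_of_nat (enum_val_nth [ffun=> false]).
  congr (_ * _%:E)%E; congr (_%:R); congr (nat_of_bool _).
  apply/idP/idP; last by move=> Bi; rewrite inE /= /bits_of_nat -(enum_val_nth [ffun=> false]).
  by rewrite inE /= /bits_of_nat -(enum_val_nth [ffun=> false]).
rewrite sumEFin; congr (_%:E).
rewrite -(big_enum_val (fun f => bits_weight f * (B f)%:R)) [RHS]big_mkcond /=.
by apply: eq_bigr => f _; case: (B f); rewrite ?mulr1 ?mulr0.
Qed.

Lemma bernoulli_product_setT : bernoulli_product setT = 1%:E.
Proof.
rewrite (_ : setT = [set n | xpredT (bits_of_nat n)]); last by apply/seteqP.
rewrite (bernoulli_productE xpredT); congr (_%:E); rewrite /bits_weight.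
rewrite -(bigA_distr_bigA (fun _ b => bit_weight b)) big1// => i _.
by rewrite big_bool /=; ring.
Qed.

HB.instance Definition _ :=
  Measure_isProbability.Build _ _ _ bernoulli_product bernoulli_product_setT.

Definition bit (i : 'I_k) (n : nat) : R := (bits_of_nat n i)%:R.

Lemma measurable_bit i : measurable_fun setT (bit i).
Proof. by []. Qed.

HB.instance Definition _ i := isMeasurableFun.Build _ _ _ _ (bit i) (measurable_bit i).

(** A sum of products over all bit vectors factors by coordinate, and coordinates outside [J] have
    total weight 1. Singleton, arbitrary and full [J] give the marginals, independence and the
    probability that all bits vanish. *)
Lemma bernoulli_product_bits (J : {set 'I_k}) (A : 'I_k -> pred bool) :
  bernoulli_product [set n | [forall i in J, A i (bits_of_nat n i)]] =
  (\prod_(i in J) \sum_(b | A i b) bit_weight b)%:E.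
Proof.
rewrite (bernoulli_productE (fun f => [forall i in J, A i (f i)])); congr (_%:E).
rewrite [RHS]big_mkcond /=.
transitivity (\prod_i \sum_b (if (i \in J) ==> A i b then bit_weight b else 0)); last first.
  apply: eq_bigr => i _; case: (i \in J) => /=; first by rewrite -big_mkcond.
  by rewrite big_bool /=; ring.
rewrite bigA_distr_bigA big_mkcond; apply: eq_bigr => f _.
have [/forallP fA|/forallPn[i fi]] := boolP [forall i in J, A i (f i)].
  by apply: eq_bigr => i _; rewrite fA.
by rewrite (bigD1 i)//= (negbTE fi) mul0r.
Qed.

End BernoulliProduct.

(** * The two bounds on the supremum and the comparison of the two terms *)

Section MaxTail.
Local Open Scope classical_set_scope.
Context {R : realType}.

Lemma bernoulli_inequality (u : R) k : u <= 1 -> 1 - k%:R * u <= (1 - u) ^+ k.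
Proof.
move=> u1; elim: k => [|k IH]; first by rewrite mul0r subr0.
have h : (1 - u) * (1 - k%:R * u) <= (1 - u) ^+ k.+1.
  by rewrite exprS ler_wpM2l// subr_ge0.
apply: le_trans h; rewrite -natr1.
have : 0 <= k%:R * (u * u) by rewrite mulr_ge0// -expr2 sqr_ge0.
lra.
Qed.

Lemma tail_le d (W : measurableType d) (P : probability W R) k (x : R)
    (X : 'I_k -> {RV P >-> R}) :
  (0 < k)%N -> 0 <= x <= 3 / (5 * k%:R - 2) -> (forall i w, 0 <= X i w) ->
  mutually_independent X -> identically_distributed X ->
  (forall i, ('E_P[X i] = x%:E)%E) ->
  (P [set w | (1 <= \sum_(i < k) X i w)%R] <= (1 - (1 - x) ^+ k)%:E)%E.
Proof.
move=> k0 xk X0 Xind Xid EX; set A := [set w | _].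
have mA : measurable A.
  rewrite (_ : A = setT `&` (fun w => \sum_(i < k) X i w) @^-1` `[1, +oo[).
    by apply: measurable_sum => // i; exact: measurable_funP.
  by rewrite setTI; apply/seteqP; split => w /=; rewrite in_itv /= andbT.
have PA : P A \is a fin_num by exact: fin_num_measure.
rewrite -(fineK PA) lee_fin; set t := fine (P A).
have t0 : 0 <= t by rewrite fine_ge0.
have t1 : t <= 1 by rewrite -lee_fin fineK// probability_le1.
apply/ler_addgt0Pr => e e0.
(* By Bernoulli's inequality the factor [(1 - k/N)^k] costs at most [k^2/N], which this [N] makes at
   most [e]; the added [k] ensures [k < N]. *)
pose N := (Num.truncn (k%:R * k%:R / e) + k).+1.
have kN : (k < N)%N by rewrite ltnS leq_addl.
have N0 : 0 < N%:R :> R by rewrite ltr0n.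
have kkN : k%:R * (k%:R / N%:R) <= e.
  rewrite mulrA ler_pdivrMr// -ler_pdivrMl// mulrC.
  apply: ltW; apply: (lt_le_trans (truncnS_gt _)).
  by rewrite ler_nat ltnS leq_addr.
have u1 : (k%:R / N%:R : R) <= 1.
  by rewrite ler_pdivrMr// mul1r ler_nat ltnW.
have := discretised_tail_le k0 xk X0 Xind Xid EX kN; rewrite -/A -/t => h.
have := ler_wpM2r t0 (bernoulli_inequality k u1).
have : k%:R * (k%:R / N%:R) * t <= e * 1 by rewrite ler_pM// mulr_ge0 ?divr_ge0.
by move: h; lra.
Qed.

Lemma le_max_tail k (x : R) : 0 <= x <= 1 ->
  ((1 - (1 - x) ^+ k)%:E <= max_tail k x)%E.
Proof.
move=> x01; pose P : probability nat R := bernoulli_product k x01.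
pose X (i : 'I_k) : {RV P >-> R} := bit i.
have Xpre i A : X i @^-1` A = [set n | [forall j in [set i]%SET, `[< A (bits_of_nat k n j)%:R >]]].
  apply/seteqP; split => n /=.
    by move=> An; apply/forall_inP => j /set1P ->; apply/asboolP.
  by move/forall_inP => /(_ i (set11 i))/asboolP.
have PX i A : P (X i @^-1` A) = (\sum_(b : bool | `[< A b%:R >]) bit_weight x b)%:E.
  rewrite Xpre.
  apply: etrans (bernoulli_product_bits x01 [set i]%SET (fun _ (b : bool) => `[< A b%:R >])) _.
  by rewrite big_set1.
apply: ereal_sup_ubound; exists default_measure_display, nat, P, X; split.
- by move=> i n; exact: ler0n.
- move=> J A _; under eq_bigr do rewrite PX; rewrite prodEFin.
  apply: etrans (bernoulli_product_bits x01 J (fun i (b : bool) => `[< A i b%:R >])).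
  congr bernoulli_product; apply/seteqP; split => n /=.
    by move=> h; apply/forall_inP => i iJ; apply/asboolP; exact: (h i iJ).
  by move=> /forall_inP h i /= iJ; have /asboolP := h i iJ.
- by move=> i j A mA; exact: etrans (PX i A) (esym (PX j A)).
- move=> i; have -> : X i = \1_(X i @^-1` [set 1]) :> (nat -> R).
    apply/funext => n; rewrite indicE; congr (nat_of_bool _)%:R.
    apply/idP/idP => [b1|]; first by rewrite inE /= /bit b1.
    by rewrite inE /= /bit; case: (bits_of_nat k n i) => //= /eqP; rewrite eq_sym oner_eq0.
  rewrite expectation_indic; last exact: measurable_funPTI.
  rewrite PX; congr (_%:E); rewrite big_mkcond big_bool /= asboolT// asboolF ?addr0//.
  by apply/eqP; rewrite eq_sym oner_eq0.
(* The bits sum to less than 1 exactly when all are 0, so the event is the complement of [Z]. *)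
- pose Z := [set n | [forall i in [set: 'I_k]%SET, ~~ bits_of_nat k n i]].
  have PZ : P Z = ((1 - x) ^+ k)%:E.
    apply: etrans (bernoulli_product_bits x01 [set: 'I_k]%SET (fun _ => negb)) _.
    congr (_%:E); rewrite big_mkcond /= -[in RHS](card_ord k) -prodr_const.
    by apply: eq_bigr => i _; rewrite inE big_mkcond big_bool /= add0r.
  rewrite EFinB -PZ -probability_setC//; congr (P _).
  apply/seteqP; split => n /=.
    move=> h; have {h} /forall_inPn[i _ /negPn bi] := introN idP h; rewrite (bigD1 i)//= /bit bi.
    by rewrite lerDl sumr_ge0.
  move=> h /forall_inP b0; move: h.
  by rewrite big1 ?ler10// => i _; rewrite /= /bit (negbTE (b0 i (finset.in_setT i))).
Qed.

(** For [k >= 3] put [y = k x], which is at most 7/10. Then [(1 - x)^k (1 + y) <= (1 - x^2)^k <= 1]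
    makes the right side at least [y / (1 + y)], while [y^k] is at most [49/100 y], which is
    smaller. *)
Lemma pow_le_pow1B k (x : R) : (0 < k)%N -> 0 <= x <= 3 / (5 * k%:R - 2) ->
  (k%:R * x) ^+ k <= 1 - (1 - x) ^+ k.
Proof.
move=> k0 /andP[x0 xk].
have k1 : 1 <= k%:R :> R by rewrite ler1n.
have kx : 5 * k%:R * x - 2 * x <= 3.
  by move: xk; rewrite ler_pdivlMr; lra.
have x1 : x <= 1 by nra.
case: k k0 k1 kx {xk} => [|[|[|j]]]// _ k1 kx.
- by rewrite !expr1; lra.
- by rewrite !expr2; nra.
set k := j.+3 in k1 kx *; set y := k%:R * x.
have k3 : 3 <= k%:R :> R by rewrite ler_nat.
have y0 : 0 <= y by rewrite mulr_ge0.
have y7 : y <= 7 / 10.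
  by rewrite /y; nra.
have h1 : (1 - x) ^+ k * (1 + y) <= 1.
  apply: (@le_trans _ _ ((1 - x) ^+ k * (1 + x) ^+ k)).
    rewrite ler_wpM2l ?exprn_ge0 ?subr_ge0//.
    have x1' : - x <= 1 by lra.
    by have := bernoulli_inequality k x1'; rewrite mulrN !opprK.
  by rewrite -exprMn exprn_ile1//; nra.
have h2 : y ^+ k <= y * (49 / 100).
  rewrite exprS ler_wpM2l// -[j.+2]addn2 exprD -[leRHS]mul1r.
  by rewrite ler_pM ?exprn_ge0 ?exprn_ile1//; [lra|rewrite expr2; nra].
have h3 : 0 <= (1 - x) ^+ k by rewrite exprn_ge0// subr_ge0.
apply: (le_trans h2); rewrite -(@ler_pM2r _ (1 + y)); first nra.
lra.
Qed.

End MaxTail.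

Theorem corollary26 (R : realType) (k : nat) (x : R) :
  (0 < k)%N ->
  0 <= x -> x <= 3 / (5 * k%:R - 2) ->
  max_tail k x = (Num.max (1 - (1 - x) ^+ k) ((k%:R * x) ^+ k))%:E.
Proof.
move=> k0 x0 xk; have x0k : 0 <= x <= 3 / (5 * k%:R - 2) by rewrite x0.
have k1 : 1 <= k%:R :> R by rewrite ler1n.
have x1 : x <= 1 by apply: le_trans xk _; rewrite ler_pdivrMr; lra.
rewrite max_l ?pow_le_pow1B//; apply/eqP; rewrite eq_le le_max_tail ?x0// andbT.
apply: ub_ereal_sup => _ [d [W [P [X [X0 Xind Xid EX ->]]]]].
exact: tail_le.
Qed.
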